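(* For any $k\in\mathbb{N}$, $k\geq 3$, and any $a\in\mathbb{R}\setminus\{0\}$, the first (i.e. smallest) eigenvalue of the Jacobi operator associated with harmonic self-maps of the ellipsoid $E_a$, evaluated at the identity map, is given by $$\lambda_1=a^2(2-k).$$ Hence the identity map, when considered as a harmonic self-map of the ellipsoid $E_a$, is unstable.
   Context: For $a\in\mathbb{R}\setminus\{0\}$, $E_a=\{x\in\mathbb{R}^{k+1} : a^{-2}x_1^2+x_2^2+\dots+x_{k+1}^2=1\}$ is the $k$-dimensional ellipsoid with induced metric, parametrized by $(\psi,\theta)\mapsto(a\cos\psi,\theta\sin\psi)$, $\psi\in[0,\pi]$, $\theta\in\mathbb{S}^{k-1}$. One considers self-maps $(\psi,\theta)\mapsto(f(\psi),\chi(\theta))$, with $\chi:\mathbb{S}^{k-1}\to\mathbb{S}^{k-1}$ an eigenmap (harmonic map with $|d\chi|^2=d(d+k-2)$ constant), and the variables $x=\log(\tan\frac{\psi}{2})\in\mathbb{R}$, $h=f-\frac{\pi}{2}$. The Jacobi operator acts on variations $\xi:\mathbb{R}\to\mathbb{R}$ of $h$ (with $\chi$ fixed), and its eigenvalue equation (Jacobi equation) at a solution $h$ is, with $A:=a^2\cos^2h+\sin^2h$ and $B:=a^2\operatorname{sech}^2x+\tanh^2x$, $$\begin{aligned} \xi''&+(1-a^2)\frac{\cos 2h}{A}h'^2\xi+(1-a^2)\frac{\sin 2h}{A}h'\xi'-\frac12(1-a^2)^2\frac{\sin^2 2h}{A^2}h'^2\xi-(1-a^2)\frac{\tanh x}{a^2+\sinh^2x}\xi'\\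 &-(k-2)\tanh x\,\xi'-\frac{d(d+k-2)}{2}(1-a^2)\frac{B}{A^2}\sin^2(2h)\,\xi+d(d+k-2)\frac{B}{A}\cos(2h)\,\xi+\lambda\frac{\xi}{\cosh^2x\;B}=0 . \end{aligned}$$ The identity map corresponds to $\chi=\mathrm{id}$, $d=1$ and $h_1(x)=-\frac{\pi}{2}+2\arctan(e^x)$. A number $\lambda\in\mathbb{R}$ is an eigenvalue of the Jacobi operator at the identity map if this equation, with $d=1$ and $h=h_1$, has a nontrivial solution $\xi:\mathbb{R}\to\mathbb{R}$ with $\int_{\mathbb{R}}\xi^2\,\operatorname{sech}^{k}x\,(a^2\operatorname{sech}^2x+\tanh^2x)^{-1/2}\,dx<\infty$ (the natural weighted $L^2$ space of this Sturm–Liouville problem). The map is called unstable if the Jacobi operator has a negative eigenvalue. *)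

(* Defs.v *)
From Stdlib Require Export Reals.
From Coquelicot Require Export Coquelicot.
Open Scope R_scope.

(* Maps (psi, theta) |-> (f psi, chi theta) of the ellipsoid E_a of dimension k,
   in the variables x = log (tan (psi / 2)) and h = f - PI / 2.  The eigenmap
   chi of S^(k-1) enters only through its degree d, by
   |d chi|^2 = d * (d + k - 2). *)

Definition sech (x : R) : R := / cosh x.

Definition chi_energy (k d : nat) : R := INR d * (INR d + INR k - 2).

Definition coefA (a : R) (h : R -> R) (x : R) : R :=
  a ^ 2 * cos (h x) ^ 2 + sin (h x) ^ 2.

Definition coefB (a x : R) : R := a ^ 2 * sech x ^ 2 + tanh x ^ 2.

(* The primes are Coquelicot's total derivatives; differentiability of the
   variation xi is required separately, in [jacobi_solution]. *)
Definition jacobi_lhs (a : R) (k d : nat) (h : R -> R) (lambda : R)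
    (xi : R -> R) (x : R) : R :=
  let A := coefA a h x in
  let B := coefB a x in
  let h' := Derive h x in
  let xi' := Derive xi x in
  let xi'' := Derive (Derive xi) x in
  xi''
  + (1 - a ^ 2) * (cos (2 * h x) / A) * h' ^ 2 * xi x
  + (1 - a ^ 2) * (sin (2 * h x) / A) * h' * xi'
  - 1 / 2 * (1 - a ^ 2) ^ 2 * (sin (2 * h x) ^ 2 / A ^ 2) * h' ^ 2 * xi x
  - (1 - a ^ 2) * (tanh x / (a ^ 2 + sinh x ^ 2)) * xi'
  - (INR k - 2) * tanh x * xi'
  - chi_energy k d / 2 * (1 - a ^ 2) * (B / A ^ 2) * sin (2 * h x) ^ 2 * xi x
  + chi_energy k d * (B / A) * cos (2 * h x) * xi x
  + lambda * (xi x / (cosh x ^ 2 * B)).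

Definition jacobi_solution (a : R) (k d : nat) (h : R -> R) (lambda : R)
    (xi : R -> R) : Prop :=
  (forall x, ex_derive xi x) /\
  (forall x, ex_derive (Derive xi) x) /\
  (forall x, jacobi_lhs a k d h lambda xi x = 0).

(* h for f = id, as psi = 2 * atan (exp x). *)
Definition h_id (x : R) : R := - (PI / 2) + 2 * atan (exp x).

(* The integrand below is continuous (when a <> 0 and xi is continuous) and
   nonnegative, so existence of the improper Riemann integral is finiteness of
   the Lebesgue integral. *)
Definition weighted_L2 (a : R) (k : nat) (xi : R -> R) : Prop :=
  ex_RInt_gen (fun x => xi x ^ 2 * sech x ^ k * / sqrt (coefB a x))
    (Rbar_locally m_infty) (Rbar_locally p_infty).

(* The identity map has chi = id, hence d = 1. *)
Definition identity_eigenvalue (a : R) (k : nat) (lambda : R) : Prop :=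
  exists xi : R -> R,
    jacobi_solution a k 1 h_id lambda xi /\
    (exists x, xi x <> 0) /\
    weighted_L2 a k xi.

Definition identity_first_eigenvalue (a : R) (k : nat) (lambda : R) : Prop :=
  identity_eigenvalue a k lambda /\
  (forall mu, identity_eigenvalue a k mu -> lambda <= mu).

Definition identity_unstable (a : R) (k : nat) : Prop :=
  exists lambda, identity_eigenvalue a k lambda /\ lambda < 0.

(* Main.v *)
Require Import Defs.
From Stdlib Require Import Reals Lra Lia Classical.
From Coquelicot Require Import Coquelicot.
Open Scope R_scope.

(* With s = sech x, t = tanh x, B = a^2 s^2 + t^2, the equation at the identity is
   of Sturm-Liouville form with leading coefficient s^(k-2) B^(1/2) and weight
   s^k B^(-1/2); the conformal-type variation s B^(-1/2) is a positive solution
   for lambda = a^2 (2 - k).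
   Writing xi = phi s B^(-1/2) removes the potential: (P phi')' = delta W phi with
   delta = a^2 (2 - k) - mu, P = s^k B^(-1/2), W = s^(k+2) B^(-3/2), and W phi^2
   is the L^2 integrand.  If delta > 0 then phi P phi' is nondecreasing and not
   identically 0, so at one of the two ends |phi|' >= const / P, which forces
   |phi| >= const e^(k |x|) there, and W phi^2 is not integrable since k >= 2. *)

(** * Hyperbolic functions: identities, derivatives, exponential bounds *)

Lemma cosh_pos (x : R) : 0 < cosh x.
Proof. unfold cosh. pose proof (exp_pos x). pose proof (exp_pos (- x)). lra. Qed.

Lemma sech_pos (x : R) : 0 < sech x.
Proof. apply Rinv_0_lt_compat, cosh_pos. Qed.

Lemma cosh2_minus_sinh2 (x : R) : cosh x * cosh x - sinh x * sinh x = 1.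
Proof.
  assert (E : exp x * exp (- x) = 1)
    by (rewrite <- exp_plus, Rplus_opp_r; apply exp_0).
  unfold cosh, sinh. nra.
Qed.

Lemma sech2_tanh2 (x : R) : sech x ^ 2 + tanh x ^ 2 = 1.
Proof.
  pose proof (cosh_pos x). pose proof (cosh2_minus_sinh2 x) as E.
  unfold sech, tanh. apply Rmult_eq_reg_r with (cosh x * cosh x); [|nra].
  transitivity (1 + sinh x * sinh x); [field; lra|lra].
Qed.

Lemma is_derive_sech (x : R) : is_derive sech x (- (sech x * tanh x)).
Proof.
  pose proof (cosh_pos x).
  assert (D : is_derive cosh x (sinh x)) by apply is_derive_Reals, derivable_pt_lim_cosh.
  replace (- (sech x * tanh x)) with (- sinh x / cosh x ^ 2)
    by (unfold sech, tanh; field; lra).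
  apply is_derive_inv; [exact D|lra].
Qed.

Lemma is_derive_tanh (x : R) : is_derive tanh x (sech x ^ 2).
Proof.
  pose proof (cosh_pos x).
  assert (D : is_derive cosh x (sinh x)) by apply is_derive_Reals, derivable_pt_lim_cosh.
  assert (D' : is_derive sinh x (cosh x)) by apply is_derive_Reals, derivable_pt_lim_sinh.
  replace (sech x ^ 2) with ((cosh x * cosh x - sinh x * sinh x) / cosh x ^ 2).
  - apply (is_derive_div sinh cosh x); [exact D'|exact D|lra].
  - pose proof (cosh2_minus_sinh2 x) as E. rewrite E.
    unfold sech. field. lra.
Qed.

Lemma sech_opp (x : R) : sech (- x) = sech x.
Proof. unfold sech, cosh. rewrite Ropp_involutive. f_equal. lra. Qed.

Lemma tanh_opp (x : R) : tanh (- x) = - tanh x.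
Proof. unfold tanh. pose proof (cosh_pos x).
  replace (cosh (- x)) with (cosh x) by (unfold cosh; rewrite Ropp_involutive; lra).
  replace (sinh (- x)) with (- sinh x) by (unfold sinh; rewrite Ropp_involutive; lra).
  field; lra.
Qed.

Lemma sech_le_exp (x : R) : sech x <= 2 * exp (- x).
Proof.
  unfold sech, cosh. pose proof (exp_pos x). pose proof (exp_pos (- x)).
  assert (E : exp x * exp (- x) = 1)
    by (rewrite <- exp_plus, Rplus_opp_r; apply exp_0).
  apply Rmult_le_reg_r with ((exp x + exp (- x)) / 2); [lra|].
  rewrite Rinv_l; nra.
Qed.

Lemma exp_le_sech (x : R) : 0 <= x -> exp (- x) <= sech x.
Proof.
  intros Hx. unfold sech, cosh. pose proof (exp_pos x). pose proof (exp_pos (- x)).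
  assert (E : exp x * exp (- x) = 1)
    by (rewrite <- exp_plus, Rplus_opp_r; apply exp_0).
  assert (exp (- x) <= exp x).
  { destruct (Req_dec x 0) as [->|]; [rewrite Ropp_0; lra|].
    left; apply exp_increasing; lra. }
  apply Rmult_le_reg_r with ((exp x + exp (- x)) / 2); [lra|].
  rewrite Rinv_l; nra.
Qed.

(** * The identity map in the variable x *)

(** Since exp x = tan (psi / 2), this and [tanh_id] are the half-angle formulas: sech x is sin psi
    and tanh x is - cos psi. They turn the trigonometric functions of [h_id] into hyperbolic
    ones. *)
Lemma sech_id (x : R) : 2 * exp x / (1 + exp x ^ 2) = sech x.
Proof.
  unfold sech, cosh. rewrite exp_Ropp. pose proof (exp_pos x). field. nra.
Qed.

Lemma tanh_id (x : R) : (exp x ^ 2 - 1) / (1 + exp x ^ 2) = tanh x.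
Proof.
  unfold tanh, sinh, cosh. rewrite exp_Ropp. pose proof (exp_pos x). field. nra.
Qed.

Lemma is_derive_h_id (x : R) : is_derive h_id x (sech x).
Proof.
  unfold h_id. rewrite <- sech_id. auto_derive; [trivial|].
  pose proof (exp_pos x). unfold Rsqr. field. nra.
Qed.

Lemma sin_h_id (x : R) : sin (h_id x) = tanh x.
Proof.
  unfold h_id. rewrite <- tanh_id.
  replace (- (PI / 2) + 2 * atan (exp x)) with (- (PI / 2 - 2 * atan (exp x))) by ring.
  rewrite sin_neg, sin_shift, cos_2a, sin_atan, cos_atan.
  unfold Rsqr. pose proof (exp_pos x). set (e := exp x) in *.
  assert (0 < sqrt (1 + e * e)) by (apply sqrt_lt_R0; nra).
  assert (E : sqrt (1 + e * e) ^ 2 = 1 + e * e) by (rewrite pow2_sqrt; nra).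
  replace (1 + e ^ 2) with (sqrt (1 + e * e) ^ 2) by lra.
  field. lra.
Qed.

Lemma cos_h_id (x : R) : cos (h_id x) = sech x.
Proof.
  unfold h_id. rewrite <- sech_id.
  replace (- (PI / 2) + 2 * atan (exp x)) with (- (PI / 2 - 2 * atan (exp x))) by ring.
  rewrite cos_neg, cos_shift, sin_2a, sin_atan, cos_atan.
  unfold Rsqr. pose proof (exp_pos x). set (e := exp x) in *.
  assert (0 < sqrt (1 + e * e)) by (apply sqrt_lt_R0; nra).
  assert (E : sqrt (1 + e * e) ^ 2 = 1 + e * e) by (rewrite pow2_sqrt; nra).
  replace (1 + e ^ 2) with (sqrt (1 + e * e) ^ 2) by lra.
  field. lra.
Qed.

(** * The coefficient B and its logarithmic derivative *)

Lemma coefB_pos (a x : R) : a <> 0 -> 0 < coefB a x.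
Proof.
  intros ha. unfold coefB. pose proof (sech_pos x).
  assert (0 < a ^ 2) by (apply pow2_gt_0; exact ha).
  assert (0 < sech x ^ 2) by (apply pow_lt; lra).
  pose proof (pow2_ge_0 (tanh x)). nra.
Qed.

(** By [sech2_tanh2], B is a convex combination of a^2 and 1; the upper bound uses their sum in
    place of their maximum. *)
Lemma coefB_bounds (a x : R) : Rmin (a ^ 2) 1 <= coefB a x <= a ^ 2 + 1.
Proof.
  unfold coefB. pose proof (sech2_tanh2 x).
  pose proof (pow2_ge_0 (sech x)). pose proof (pow2_ge_0 (tanh x)).
  pose proof (pow2_ge_0 a).
  pose proof (Rmin_l (a ^ 2) 1). pose proof (Rmin_r (a ^ 2) 1).
  set (m := Rmin (a ^ 2) 1) in *. nra.
Qed.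

(* [B' / (2 B)] for [B = coefB a]. *)
Definition dlogB (a x : R) : R := (1 - a ^ 2) * tanh x * sech x ^ 2 / coefB a x.

Lemma is_derive_coefB (a x : R) : a <> 0 ->
  is_derive (coefB a) x (2 * (dlogB a x * coefB a x)).
Proof.
  intros ha. pose proof (coefB_pos a x ha).
  pose proof (is_derive_sech x) as D1. pose proof (is_derive_tanh x) as D2.
  unfold coefB at 1. auto_derive.
  - repeat split; eexists; eassumption.
  - rewrite (is_derive_unique _ _ _ D1 : Derive (fun x0 => sech x0) x = _).
    rewrite (is_derive_unique _ _ _ D2 : Derive (fun x0 => tanh x0) x = _).
    unfold dlogB. field. lra.
Qed.

(** Quotient rule for N / B: the term - N B' / B^2 equals - 2 [dlogB]^2, because B' / B is 2
    [dlogB]. *)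
Lemma is_derive_dlogB (a x : R) : a <> 0 ->
  is_derive (dlogB a) x
    ((1 - a ^ 2) * (sech x ^ 4 - 2 * tanh x ^ 2 * sech x ^ 2) / coefB a x
     - 2 * dlogB a x ^ 2).
Proof.
  intros ha. pose proof (coefB_pos a x ha).
  pose proof (is_derive_sech x) as D1. pose proof (is_derive_tanh x) as D2.
  pose proof (is_derive_coefB a x ha) as D3.
  unfold dlogB at 1. auto_derive.
  - repeat split; try (eexists; eassumption); lra.
  - rewrite (is_derive_unique _ _ _ D1 : Derive (fun x0 => sech x0) x = _).
    rewrite (is_derive_unique _ _ _ D2 : Derive (fun x0 => tanh x0) x = _).
    rewrite (is_derive_unique _ _ _ D3 : Derive (fun x0 => coefB a x0) x = _).
    unfold dlogB. field. lra.
Qed.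

(** * The Jacobi equation at the identity and its positive solution *)

(** At the identity A = B, h' = sech x and a^2 + sinh^2 x = B / sech^2 x. The two first-order terms
    carrying 1 - a^2 are then 2 [dlogB] and - [dlogB], and the energy of chi is k - 1. *)
Lemma jacobi_lhs_id (a : R) (k : nat) (lambda : R) (xi : R -> R) (x : R) : a <> 0 ->
  jacobi_lhs a k 1 h_id lambda xi x =
  Derive (Derive xi) x + (dlogB a x - (INR k - 2) * tanh x) * Derive xi x
  + (Derive (dlogB a) x + (INR k - 1) * (sech x ^ 2 - tanh x ^ 2)
     - (2 * INR k - 3) * tanh x * dlogB a x + lambda * sech x ^ 2 / coefB a x) * xi x.
Proof.
  intros ha. unfold jacobi_lhs. cbv zeta.
  rewrite (is_derive_unique _ _ _ (is_derive_dlogB a x ha)).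
  rewrite (is_derive_unique _ _ _ (is_derive_h_id x)).
  replace (coefA a h_id x) with (coefB a x)
    by (unfold coefA, coefB; rewrite sin_h_id, cos_h_id; reflexivity).
  rewrite sin_2a, cos_2a, sin_h_id, cos_h_id.
  pose proof (coefB_pos a x ha). pose proof (cosh_pos x) as C. pose proof (sech_pos x).
  replace (a ^ 2 + sinh x ^ 2) with (coefB a x / sech x ^ 2).
  2:{ unfold coefB, sech, tanh. field. lra. }
  replace (cosh x ^ 2) with (/ sech x ^ 2) by (unfold sech; field; lra).
  unfold chi_energy, dlogB. simpl INR. field. lra.
Qed.

(* The identity behind the value [a ^ 2 * (2 - k)]. *)
Lemma ground_state_potential (a x : R) (n : R) : a <> 0 ->
  (n - 2) * (sech x ^ 2 - tanh x * dlogB a x)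
  = - (a ^ 2 * (2 - n)) * sech x ^ 2 / coefB a x.
Proof.
  intros ha. pose proof (coefB_pos a x ha) as HB. pose proof (sech2_tanh2 x) as E.
  unfold dlogB. apply Rmult_eq_reg_r with (coefB a x); [|lra].
  transitivity ((n - 2) * sech x ^ 2 * (coefB a x - (1 - a ^ 2) * tanh x ^ 2)).
  { field. lra. }
  transitivity ((n - 2) * sech x ^ 2 * a ^ 2 * (sech x ^ 2 + tanh x ^ 2)).
  { unfold coefB. ring. }
  rewrite E. field. lra.
Qed.

(** In psi this is sin psi / sqrt (a^2 sin^2 psi + cos^2 psi), the psi-component of sin psi times
    the unit meridian field, which is a conformal field on the ellipsoid. *)
Definition ground_state (a x : R) : R := sech x / sqrt (coefB a x).

(** Logarithmic derivative: sech contributes - tanh, and B^(-1/2) contributes - [dlogB]. *)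
Lemma is_derive_ground_state (a x : R) : a <> 0 ->
  is_derive (ground_state a) x (- (tanh x + dlogB a x) * ground_state a x).
Proof.
  intros ha. pose proof (coefB_pos a x ha) as HB.
  pose proof (sqrt_lt_R0 _ HB) as HS.
  pose proof (is_derive_sech x) as D1. pose proof (is_derive_coefB a x ha) as D3.
  unfold ground_state at 1. auto_derive.
  - repeat split; try (eexists; eassumption); lra.
  - rewrite (is_derive_unique _ _ _ D1 : Derive (fun x0 => sech x0) x = _).
    rewrite (is_derive_unique _ _ _ D3 : Derive (fun x0 => coefB a x0) x = _).
    unfold ground_state.
    assert (E : coefB a x = sqrt (coefB a x) ^ 2) by (rewrite pow2_sqrt; lra).
    set (S := sqrt (coefB a x)) in *. rewrite E. field. lra.
Qed.

(** After substitution the derivative and the square of [dlogB] cancel. What multiplies the ground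
    state is (k - 2) (sech^2 x - tanh x [dlogB]) + lambda sech^2 x / B, which vanishes by
    [ground_state_potential]. *)
Lemma ground_state_solution (a : R) (k : nat) : a <> 0 ->
  jacobi_solution a k 1 h_id (a ^ 2 * (2 - INR k)) (ground_state a).
Proof.
  intros ha.
  assert (D1 : forall x, Derive (ground_state a) x
                         = - (tanh x + dlogB a x) * ground_state a x)
    by (intros; apply is_derive_unique, is_derive_ground_state, ha).
  assert (D2 : forall x, is_derive (Derive (ground_state a)) x
     (((tanh x + dlogB a x) ^ 2 - (sech x ^ 2 + Derive (dlogB a) x)) * ground_state a x)).
  { intros x.
    apply is_derive_ext with (fun y => - (tanh y + dlogB a y) * ground_state a y);
      [intros; symmetry; apply D1|].
    pose proof (is_derive_ground_state a x ha) as E1.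
    pose proof (is_derive_dlogB a x ha) as E2.
    pose proof (is_derive_tanh x) as E3.
    auto_derive.
    - repeat split; eexists; eassumption.
    - rewrite (is_derive_unique _ _ _ E1 : Derive (fun x0 => ground_state a x0) x = _).
      rewrite (is_derive_unique _ _ _ E3 : Derive (fun x0 => tanh x0) x = _).
      change (fun x0 => dlogB a x0) with (dlogB a). ring. }
  repeat split; intros x.
  - eexists; apply is_derive_ground_state, ha.
  - eexists; apply D2.
  - rewrite jacobi_lhs_id by exact ha.
    rewrite (is_derive_unique _ _ _ (D2 x)), D1.
    pose proof (ground_state_potential a x (INR k) ha) as E.
    replace (a ^ 2 * (2 - INR k) * sech x ^ 2 / coefB a x)
      with (- ((INR k - 2) * (sech x ^ 2 - tanh x * dlogB a x)))
      by (rewrite E; field; pose proof (coefB_pos a x ha); lra).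
    ring.
Qed.

(** * Monotone functions and improper integrals *)

Lemma nondecreasing_of_deriv (f df : R -> R) (a b : R) :
  (forall x, a <= x <= b -> is_derive f x (df x)) ->
  (forall x, a <= x <= b -> 0 <= df x) -> a <= b -> f a <= f b.
Proof.
  intros D Hp [Hab | ->]; [|lra].
  destruct (MVT_cor2 f df a b Hab) as (c & E & Hc).
  - intros c Hc. apply is_derive_Reals, D, Hc.
  - pose proof (Hp c ltac:(lra)). nra.
Qed.

Lemma nondecreasing_bounded_limit (F : R -> R) (M : R) :
  (forall x y, x <= y -> F x <= F y) -> (forall x, F x <= M) ->
  exists l, filterlim F (Rbar_locally p_infty) (locally l).
Proof.
  intros Hm Hb.
  destruct (completeness (fun y => exists x, y = F x)) as (l & Hub & Hl).
  - exists M. intros y (x & ->). apply Hb.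
  - exists (F 0), 0. reflexivity.
  - exists l. apply filterlim_locally. intros eps.
    destruct (classic (exists x, l - eps < F x)) as [(x & Hx) | Hn].
    + exists x. intros y Hy.
      pose proof (Hm x y ltac:(lra)). pose proof (Hub (F y) (ex_intro _ y eq_refl)).
      apply Rabs_def1; unfold minus, plus, opp; simpl; pose proof (cond_pos eps); lra.
    + exfalso. assert (l <= l - eps).
      { apply Hl. intros y (x & ->). apply Rnot_lt_le. intros Hx. apply Hn. exists x; lra. }
      pose proof (cond_pos eps). lra.
Qed.

(** Comparison test, with the dominating function given through a bounded antiderivative H. If F is
    the integral of f from 0, then F and H - F are both nondecreasing, so F is bounded by 2 M and
    converges at both ends. *)
Lemma ex_RInt_gen_dominated (f h H : R -> R) (M : R) :
  (forall x, continuous f x) -> (forall x, 0 <= f x <= h x) ->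
  (forall x, is_derive H x (h x)) -> (forall x, Rabs (H x) <= M) ->
  ex_RInt_gen f (Rbar_locally m_infty) (Rbar_locally p_infty).
Proof.
  intros Hc Hp DH HM. set (F := RInt f 0).
  assert (DF : forall x, is_derive F x (f x)).
  { intros x. apply (is_derive_RInt f F 0 x).
    - exists (mkposreal 1 Rlt_0_1). intros y _.
      apply (RInt_correct f), (ex_RInt_continuous f). intros; apply Hc.
    - apply Hc. }
  assert (Hm : forall x y, x <= y -> F x <= F y).
  { intros x y Hxy. apply nondecreasing_of_deriv with f; auto. intros; apply Hp. }
  assert (Hm' : forall x y, x <= y -> H x - F x <= H y - F y).
  { intros x y Hxy.
    apply (nondecreasing_of_deriv (fun z => H z - F z) (fun z => h z - f z)); auto.
    - intros z _. apply (is_derive_minus H F); auto.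
    - intros z _. pose proof (Hp z). lra. }
  assert (F0 : F 0 = 0) by (apply (RInt_point 0 f)).
  assert (Hb : forall x, Rabs (F x) <= 2 * M).
  { intros x. pose proof (HM x) as E1. pose proof (HM 0) as E2.
    apply Rabs_le_between in E1, E2. apply Rabs_le_between.
    destruct (Rle_or_lt 0 x) as [Hx|Hx].
    - pose proof (Hm 0 x Hx). pose proof (Hm' 0 x Hx). lra.
    - pose proof (Hm x 0 ltac:(lra)). pose proof (Hm' x 0 ltac:(lra)). lra. }
  destruct (nondecreasing_bounded_limit F (2 * M)) as (lp & Hlp); [exact Hm| |].
  { intros x. pose proof (Hb x) as E. apply Rabs_le_between in E. apply E. }
  (* The left end is reached by reflection: x |-> - F (- x) is again nondecreasing and bounded, and
     F tends to - [lm] there. *)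
  destruct (nondecreasing_bounded_limit (fun x => - F (- x)) (2 * M)) as (lm & Hlm).
  { intros x y Hxy. pose proof (Hm (- y) (- x) ltac:(lra)). lra. }
  { intros x. pose proof (Hb (- x)) as E. apply Rabs_le_between in E. lra. }
  assert (Hlm' : filterlim F (Rbar_locally m_infty) (locally (- lm))).
  { apply filterlim_ext with (fun x => - (- F (- - x))).
    { intros x. rewrite !Ropp_involutive. reflexivity. }
    apply (filterlim_comp _ _ _ (fun x => - F (- - x)) Ropp _ (locally lm)).
    - apply (filterlim_comp _ _ _ Ropp (fun x => - F (- x)) _ (Rbar_locally p_infty)).
      + apply (filterlim_Rbar_opp m_infty).
      + exact Hlm.
    - apply (filterlim_opp lm). }
  exists (lp - - lm).
  apply is_RInt_gen_ext with (Derive F).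
  { apply filter_forall. intros ab x _. apply is_derive_unique, DF. }
  apply is_RInt_gen_Derive; auto.
  - apply filter_forall. intros ab x _. exists (f x). apply DF.
  - apply filter_forall. intros ab x _.
    apply continuous_ext with f; [intros y; symmetry; apply is_derive_unique, DF|apply Hc].
Qed.

(** Cauchy criterion. Far enough out, two partial integrals are within c / 4 of the limit, so they
    differ by less than c; but if their moving endpoints are 1 apart and f >= c in between, they
    differ by at least c. *)
Lemma ex_RInt_gen_tails (f : R -> R) (c N : R) :
  ex_RInt_gen f (Rbar_locally m_infty) (Rbar_locally p_infty) -> 0 < c ->
  ~ (forall x, N <= x -> c <= f x) /\ ~ (forall x, N <= x -> c <= f (- x)).
Proof.
  intros (l & Hl) Hc.
  assert (Heps : 0 < c / 4) by lra.
  destruct (Hl (fun y => Rabs (y - l) < c / 4)) as [Q R [u Hu] [v Hv] HQR].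
  { exists (mkposreal _ Heps). intros y Hy. exact Hy. }
  simpl in HQR.
  assert (Hcc : forall p q, p < q -> is_RInt (fun _ => c) p q (c * (q - p))).
  { intros p q _. rewrite Rmult_comm. apply (is_RInt_const p q c). }
  split; intros Hf.
  - set (p := Rmax N (Rmax v 0) + 1).
    assert (Hp : N < p /\ v < p).
    { unfold p. pose proof (Rmax_l N (Rmax v 0)). pose proof (Rmax_r N (Rmax v 0)).
      pose proof (Rmax_l v 0). lra. }
    destruct (HQR (u - 1) p) as (y1 & I1 & E1); [apply Hu; lra|apply Hv; lra|].
    destruct (HQR (u - 1) (p + 1)) as (y2 & I2 & E2); [apply Hu; lra|apply Hv; lra|].
    simpl in I1, I2.
    pose proof (is_RInt_Chasles f p (u - 1) (p + 1) _ _ (is_RInt_swap _ _ _ _ I1) I2) as I3.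
    assert (c * (p + 1 - p) <= plus (opp y1) y2) as H.
    { apply (is_RInt_le (fun _ => c) f p (p + 1)); [lra|apply Hcc; lra|exact I3|].
      intros x Hx. apply Hf. lra. }
    unfold plus, opp in H; simpl in H.
    apply Rabs_lt_between in E1, E2. lra.
  - set (p := - (Rmax N (Rmax (- u) 0) + 1)).
    assert (Hp : p < - N /\ p < u).
    { unfold p. pose proof (Rmax_l N (Rmax (- u) 0)). pose proof (Rmax_r N (Rmax (- u) 0)).
      pose proof (Rmax_l (- u) 0). lra. }
    destruct (HQR p (v + 1)) as (y1 & I1 & E1); [apply Hu; lra|apply Hv; lra|].
    destruct (HQR (p - 1) (v + 1)) as (y2 & I2 & E2); [apply Hu; lra|apply Hv; lra|].
    simpl in I1, I2.
    pose proof (is_RInt_Chasles f (p - 1) (v + 1) p _ _ I2 (is_RInt_swap _ _ _ _ I1)) as I3.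
    assert (c * (p - (p - 1)) <= plus y2 (opp y1)) as H.
    { apply (is_RInt_le (fun _ => c) f (p - 1) p); [lra|apply Hcc; lra|exact I3|].
      intros x Hx. rewrite <- (Ropp_involutive x). apply Hf. lra. }
    unfold plus, opp in H; simpl in H.
    apply Rabs_lt_between in E1, E2. lra.
Qed.

(** * Growth of solutions of a Sturm-Liouville system *)

(* The first-order form of [(P phi')' = delta W phi], with [Q = P phi']. *)
Definition sl_system (P W : R -> R) (delta : R) (phi Q : R -> R) : Prop :=
  forall x, is_derive phi x (Q x / P x) /\ is_derive Q x (delta * W x * phi x).

(** For even coefficients, reflection exchanges the two ends and reverses the sign of phi Q, so
    growth needs to be studied only to the right. *)
Lemma sl_system_reflect (P W : R -> R) (delta : R) (phi Q : R -> R) :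
  (forall x, P (- x) = P x) -> (forall x, W (- x) = W x) ->
  sl_system P W delta phi Q ->
  sl_system P W delta (fun x => phi (- x)) (fun x => - Q (- x)).
Proof.
  intros HP HW H x. destruct (H (- x)) as [D1 D2].
  assert (Dopp : is_derive Ropp x (- 1)) by (auto_derive; lra).
  pose proof (is_derive_comp phi Ropp x _ _ D1 Dopp) as E1.
  pose proof (is_derive_opp _ _ _ (is_derive_comp Q Ropp x _ _ D2 Dopp)) as E2.
  rewrite HP in E1. rewrite HW in E2. split.
  - replace (- Q (- x) / P x) with (scal (- 1) (Q (- x) / P x)); [exact E1|].
    unfold scal; simpl; unfold mult; simpl. unfold Rdiv. ring.
  - replace (delta * W x * phi (- x)) with (opp (scal (- 1) (delta * W x * phi (- x))));
      [exact E2|].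
    unfold opp, scal; simpl; unfold mult; simpl. ring.
Qed.

(** The energy identity behind the growth: for positive [delta] and W the derivative is a sum of two
    nonnegative terms, so phi Q is nondecreasing. *)
Lemma sl_is_derive_product (P W : R -> R) (delta : R) (phi Q : R -> R) (x : R) :
  (forall x, 0 < P x) -> sl_system P W delta phi Q ->
  is_derive (fun y => phi y * Q y) x (Q x ^ 2 / P x + delta * W x * phi x ^ 2).
Proof.
  intros P_pos system. destruct (system x) as [D1 D2].
  auto_derive.
  - repeat split; eexists; eassumption.
  - rewrite (is_derive_unique _ _ _ D1 : Derive (fun x0 => phi x0) x = _).
    rewrite (is_derive_unique _ _ _ D2 : Derive (fun x0 => Q x0) x = _).
    field. pose proof (P_pos x); lra.
Qed.

(** If phi Q vanished identically, so would its derivative; but that is at least [delta] W phi^2,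
    which is positive wherever phi is nonzero. *)
Lemma sl_product_nonzero (P W : R -> R) (delta : R) (phi Q : R -> R) :
  (forall x, 0 < P x) -> (forall x, 0 < W x) -> 0 < delta ->
  sl_system P W delta phi Q -> (exists x, phi x <> 0) -> exists x, phi x * Q x <> 0.
Proof.
  intros P_pos W_pos delta_pos system (x & Hx).
  destruct (classic (exists y, phi y * Q y <> 0)) as [|Hn]; [assumption|].
  exfalso.
  assert (E0 : forall y, phi y * Q y = 0).
  { intros y. destruct (Req_dec (phi y * Q y) 0); [assumption|].
    exfalso; apply Hn; exists y; assumption. }
  pose proof (is_derive_unique _ _ _ (sl_is_derive_product P W delta phi Q x P_pos system)) as E.
  rewrite (Derive_ext _ (fun _ => 0)) in E by exact E0.
  rewrite Derive_const in E.
  assert (0 < phi x ^ 2) by (apply pow2_gt_0; exact Hx).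
  assert (0 < delta * W x * phi x ^ 2)
    by (apply Rmult_lt_0_compat; [apply Rmult_lt_0_compat; auto|assumption]).
  assert (0 <= Q x ^ 2 / P x)
    by (apply Rmult_le_pos; [apply pow2_ge_0|left; apply Rinv_0_lt_compat; auto]).
  lra.
Qed.

(* [phi * Q] stays positive to the right of [x0], so [Q ^ 2] increases and
   [|phi|' = |Q| / P] is bounded below by [|Q x0| / P]. *)
Lemma sl_exp_growth (P W : R -> R) (delta : R) (phi Q : R -> R) (n C x0 : R) :
  (forall x, 0 < P x) -> (forall x, 0 < W x) -> 0 < delta ->
  sl_system P W delta phi Q -> 0 < n -> 0 < C ->
  (forall x, P x <= C * exp (- (n * x))) -> 0 < phi x0 * Q x0 ->
  exists eps, 0 < eps /\ forall x, x0 <= x -> eps * exp (n * x) <= Rabs (phi x).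
Proof.
  intros P_pos W_pos delta_pos system Hn HC HP HG.
  assert (G_pos : forall x, x0 <= x -> 0 < phi x * Q x).
  { intros x Hx. apply Rlt_le_trans with (1 := HG).
    apply (nondecreasing_of_deriv _ _ x0 x
             (fun y _ => sl_is_derive_product P W delta phi Q y P_pos system)); [|exact Hx].
    intros y _. apply Rplus_le_le_0_compat.
    - apply Rmult_le_pos; [apply pow2_ge_0|left; apply Rinv_0_lt_compat; auto].
    - apply Rmult_le_pos; [|apply pow2_ge_0].
      left; apply Rmult_lt_0_compat; auto. }
  assert (Q_mono : forall x, x0 <= x -> Rabs (Q x0) <= Rabs (Q x)).
  { intros x Hx. apply Rsqr_le_abs_0. unfold Rsqr.
    apply (nondecreasing_of_deriv (fun y => Q y * Q y)
             (fun y => 2 * delta * W y * (phi y * Q y)) x0 x); [| |exact Hx].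
    - intros y _. destruct (system y) as [_ D]. auto_derive.
      + repeat split; eexists; eassumption.
      + rewrite (is_derive_unique _ _ _ D : Derive (fun x0 => Q x0) y = _). ring.
    - intros y Hy. pose proof (W_pos y). pose proof (G_pos y ltac:(lra)).
      apply Rmult_le_pos; [|lra]. apply Rmult_le_pos; lra. }
  assert (phi0 : phi x0 <> 0) by (intros E; rewrite E in HG; lra).
  assert (Q0 : Q x0 <> 0) by (intros E; rewrite E in HG; lra).
  apply Rabs_pos_lt in phi0, Q0.
  set (q := Rabs (Q x0)) in *.
  (* The first bound makes the derivative of eps exp (n x) at most (q / C) exp (n x), hence at most
     |Q| / P; the second gives the inequality at [x0]. So |phi| - eps exp (n x) starts nonnegative
     and is nondecreasing. *)
  set (eps := Rmin (q / (C * n)) (Rabs (phi x0) / exp (n * x0))).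
  assert (E1 : eps * n <= q / C).
  { replace (q / C) with (q / (C * n) * n) by (field; lra).
    apply Rmult_le_compat_r; [lra|apply Rmin_l]. }
  assert (E2 : eps * exp (n * x0) <= Rabs (phi x0)).
  { pose proof (exp_pos (n * x0)).
    replace (Rabs (phi x0)) with (Rabs (phi x0) / exp (n * x0) * exp (n * x0))
      by (field; lra).
    apply Rmult_le_compat_r; [lra|apply Rmin_r]. }
  assert (Heps : 0 < eps).
  { apply Rmin_pos; apply Rdiv_lt_0_compat; try assumption; [nra|apply exp_pos]. }
  exists eps. split; [exact Heps|]. intros x Hx.
  assert (H : Rabs (phi x0) - eps * exp (n * x0) <= Rabs (phi x) - eps * exp (n * x)).
  { apply (nondecreasing_of_deriv (fun y => Rabs (phi y) - eps * exp (n * y))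
             (fun y => Rabs (Q y) / P y - eps * n * exp (n * y)) x0 x); [| |exact Hx].
    - intros y Hy. pose proof (G_pos y ltac:(lra)) as Gy.
      assert (Hphi : phi y <> 0) by (intros E; rewrite E in Gy; lra).
      (* As phi Q > 0, phi and Q have the same sign, so sign (phi) Q = |Q|. *)
      assert (D : is_derive (fun y => Rabs (phi y)) y (Rabs (Q y) / P y)).
      { replace (Rabs (Q y) / P y) with (sign (phi y) * (Q y / P y)).
        - apply is_derive_Rabs; [apply system|exact Hphi].
        - destruct (Rlt_or_le (phi y) 0) as [Hs|Hs].
          + rewrite sign_eq_m1, Rabs_left by nra. unfold Rdiv; ring.
          + rewrite sign_eq_1, Rabs_right by nra. unfold Rdiv; ring. }
      apply (is_derive_minus (fun y => Rabs (phi y)) (fun y => eps * exp (n * y)));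
        [exact D|auto_derive; [trivial|ring]].
    - intros y Hy. pose proof (Q_mono y ltac:(lra)) as Qy.
      pose proof (P_pos y). pose proof (exp_pos (n * y)). pose proof (HP y) as Py.
      rewrite exp_Ropp in Py.
      assert (q / C * exp (n * y) <= Rabs (Q y) / P y).
      { apply Rle_trans with (q / P y).
        - apply Rmult_le_reg_r with (P y); [lra|].
          replace (q / P y * P y) with (q / C * exp (n * y) * (C * / exp (n * y)))
            by (field; lra).
          apply Rmult_le_compat_l; [|exact Py].
          apply Rmult_le_pos; [|lra]. left; apply Rdiv_lt_0_compat; assumption.
        - apply Rmult_le_compat_r; [|exact Qy].
          left; apply Rinv_0_lt_compat; assumption. }
      assert (eps * n * exp (n * y) <= q / C * exp (n * y))
        by (apply Rmult_le_compat_r; lra).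
      lra. }
  lra.
Qed.

(** * Coefficient and weight of the transformed problem *)

Lemma exp_pow_INR (x : R) (n : nat) : exp x ^ n = exp (INR n * x).
Proof.
  induction n as [|n IH].
  - simpl. rewrite Rmult_0_l, exp_0. reflexivity.
  - rewrite S_INR, Rmult_plus_distr_r, exp_plus, <- IH. simpl. rewrite Rmult_1_l. ring.
Qed.

Lemma is_derive_sech_pow (n : nat) (x : R) :
  is_derive (fun y => sech y ^ n) x (- (INR n * tanh x * sech x ^ n)).
Proof.
  pose proof (is_derive_pow sech n x _ (is_derive_sech x)) as D.
  replace (- (INR n * tanh x * sech x ^ n))
    with (INR n * - (sech x * tanh x) * sech x ^ pred n); [exact D|].
  (* The power rule has exponent [pred n]; for n = 0 the factor [INR n] makes both sides zero. *)
  destruct n; simpl pred; [simpl; ring|rewrite <- tech_pow_Rmult; ring].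
Qed.

Lemma sqrt_coefB_bounds (a x : R) :
  sqrt (Rmin (a ^ 2) 1) <= sqrt (coefB a x) <= sqrt (a ^ 2 + 1).
Proof. split; apply sqrt_le_1_alt, coefB_bounds. Qed.

(* Leading coefficient and weight after writing [xi = phi * ground_state a]. *)
Definition gs_coef (a : R) (k : nat) (x : R) : R := sech x ^ k / sqrt (coefB a x).

Definition gs_weight (a : R) (k : nat) (x : R) : R :=
  sech x ^ (k + 2) / (coefB a x * sqrt (coefB a x)).

Lemma gs_coef_pos (a : R) (k : nat) (x : R) : a <> 0 -> 0 < gs_coef a k x.
Proof.
  intros ha. apply Rdiv_lt_0_compat.
  - apply pow_lt, sech_pos.
  - apply sqrt_lt_R0, coefB_pos, ha.
Qed.

Lemma gs_weight_pos (a : R) (k : nat) (x : R) : a <> 0 -> 0 < gs_weight a k x.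
Proof.
  intros ha. apply Rdiv_lt_0_compat.
  - apply pow_lt, sech_pos.
  - apply Rmult_lt_0_compat; [|apply sqrt_lt_R0]; apply coefB_pos, ha.
Qed.

Lemma coefB_opp (a x : R) : coefB a (- x) = coefB a x.
Proof. unfold coefB. rewrite sech_opp, tanh_opp. ring. Qed.

(** From sech x <= 2 exp (- x) and the lower bound on B; this is the decay required by
    [sl_exp_growth] with n = k. *)
Lemma gs_coef_upper (a : R) (k : nat) (x : R) : a <> 0 ->
  gs_coef a k x <= 2 ^ k / sqrt (Rmin (a ^ 2) 1) * exp (- (INR k * x)).
Proof.
  intros ha. pose proof (sqrt_coefB_bounds a x) as [Hm _].
  assert (Hm0 : 0 < sqrt (Rmin (a ^ 2) 1)).
  { apply sqrt_lt_R0, Rmin_pos; [apply pow2_gt_0, ha|lra]. }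
  replace (2 ^ k / sqrt (Rmin (a ^ 2) 1) * exp (- (INR k * x)))
    with ((2 * exp (- x)) ^ k * / sqrt (Rmin (a ^ 2) 1)).
  - apply Rmult_le_compat.
    + apply pow_le, Rlt_le, sech_pos.
    + apply Rlt_le, Rinv_0_lt_compat; lra.
    + apply pow_incr. split; [apply Rlt_le, sech_pos|apply sech_le_exp].
    + apply Rinv_le_contravar; assumption.
  - rewrite Rpow_mult_distr, exp_pow_INR.
    replace (INR k * - x) with (- (INR k * x)) by ring. field. lra.
Qed.

(** On the right half-line sech x >= exp (- x), so the weight decays no faster than exp (- (k + 2)
    x), to be set against the growth of phi^2. *)
Lemma gs_weight_lower (a : R) (k : nat) (x : R) : a <> 0 -> 0 <= x ->
  exp (- (INR (k + 2) * x)) / ((a ^ 2 + 1) * sqrt (a ^ 2 + 1)) <= gs_weight a k x.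
Proof.
  intros ha Hx. pose proof (sqrt_coefB_bounds a x) as [_ HM].
  pose proof (coefB_bounds a x) as [_ HM']. pose proof (coefB_pos a x ha) as HB.
  pose proof (sqrt_lt_R0 _ HB).
  apply Rmult_le_compat.
  - apply Rlt_le, exp_pos.
  - apply Rlt_le, Rinv_0_lt_compat, Rmult_lt_0_compat; lra.
  - replace (- (INR (k + 2) * x)) with (INR (k + 2) * - x) by ring.
    rewrite <- exp_pow_INR. apply pow_incr. split; [apply Rlt_le, exp_pos|].
    apply exp_le_sech, Hx.
  - apply Rinv_le_contravar; [apply Rmult_lt_0_compat; assumption|].
    apply Rmult_le_compat; lra.
Qed.

(** The factor sech^k is at most 1; sech^2 is kept because its antiderivative tanh is bounded. *)
Lemma gs_weight_upper (a : R) (k : nat) (x : R) : a <> 0 ->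
  gs_weight a k x <= / (Rmin (a ^ 2) 1 * sqrt (Rmin (a ^ 2) 1)) * sech x ^ 2.
Proof.
  intros ha. pose proof (sqrt_coefB_bounds a x) as [Hm _].
  pose proof (coefB_bounds a x) as [Hm' _]. pose proof (sech_pos x) as Hs.
  assert (Hm0 : 0 < Rmin (a ^ 2) 1) by (apply Rmin_pos; [apply pow2_gt_0, ha|lra]).
  pose proof (sqrt_lt_R0 _ Hm0).
  rewrite Rmult_comm. apply Rmult_le_compat.
  - apply pow_le; lra.
  - apply Rlt_le, Rinv_0_lt_compat, Rmult_lt_0_compat; lra.
  - rewrite pow_add. pose proof (sech2_tanh2 x). pose proof (pow2_ge_0 (tanh x)).
    assert (sech x ^ k <= 1 ^ k) as Hk by (apply pow_incr; split; nra).
    rewrite pow1 in Hk. pose proof (pow2_ge_0 (sech x)). nra.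
  - apply Rinv_le_contravar; [apply Rmult_lt_0_compat; lra|].
    apply Rmult_le_compat; lra.
Qed.

(** The original weight times the square of the ground state is [gs_weight]; hence the L^2 integrand
    of xi is W phi^2. *)
Lemma gs_weight_square (a : R) (k : nat) (x z : R) : a <> 0 ->
  gs_weight a k x * (z / ground_state a x) ^ 2
  = z ^ 2 * sech x ^ k * / sqrt (coefB a x).
Proof.
  intros ha. pose proof (coefB_pos a x ha) as HB. pose proof (sqrt_lt_R0 _ HB).
  pose proof (sech_pos x).
  assert (E : coefB a x = sqrt (coefB a x) ^ 2) by (rewrite pow2_sqrt; lra).
  unfold gs_weight, ground_state. rewrite pow_add.
  set (S := sqrt (coefB a x)) in *. rewrite E. field. lra.
Qed.

Lemma ground_state_pos (a x : R) : a <> 0 -> 0 < ground_state a x.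
Proof.
  intros ha. apply Rdiv_lt_0_compat; [apply sech_pos|apply sqrt_lt_R0, coefB_pos, ha].
Qed.

Lemma ground_state_weighted_L2 (a : R) (k : nat) : a <> 0 ->
  weighted_L2 a k (ground_state a).
Proof.
  intros ha. unfold weighted_L2.
  set (C := / (Rmin (a ^ 2) 1 * sqrt (Rmin (a ^ 2) 1))).
  assert (HC : 0 < C).
  { assert (Hm0 : 0 < Rmin (a ^ 2) 1) by (apply Rmin_pos; [apply pow2_gt_0, ha|lra]).
    apply Rinv_0_lt_compat, Rmult_lt_0_compat; [|apply sqrt_lt_R0]; exact Hm0. }
  (* For the ground state itself phi = 1, so the integrand is the weight W. *)
  apply ex_RInt_gen_ext_eq with (gs_weight a k).
  { intros x. pose proof (ground_state_pos a x ha).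
    rewrite <- gs_weight_square by exact ha.
    rewrite Rdiv_diag by lra. rewrite pow1, Rmult_1_r. reflexivity. }
  apply ex_RInt_gen_dominated with (fun x => C * sech x ^ 2) (fun x => C * tanh x) C.
  - intros x. apply (ex_derive_continuous (gs_weight a k)).
    pose proof (coefB_pos a x ha) as HB. pose proof (sqrt_lt_R0 _ HB).
    pose proof (is_derive_sech_pow (k + 2) x). pose proof (is_derive_coefB a x ha).
    unfold gs_weight. apply ex_derive_div.
    + eexists; eassumption.
    + auto_derive. repeat split; first [exact HB | eexists; eassumption].
    + nra.
  - intros x. split; [apply Rlt_le, gs_weight_pos, ha|apply gs_weight_upper, ha].
  - intros x. apply (is_derive_scal tanh x C). apply is_derive_tanh.
  - intros x. rewrite Rabs_mult, (Rabs_right C) by lra.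
    rewrite <- (Rmult_1_r C) at 2. apply Rmult_le_compat_l; [lra|].
    pose proof (sech2_tanh2 x). pose proof (pow2_ge_0 (sech x)).
    apply Rabs_le. split; nra.
Qed.

(** * Removing the potential by the ground state *)

(** With g the ground state, P / g = sech^(k-1) and g' / g = - (tanh + [dlogB]), so the second
    function is P (xi / g)'. The bound on k makes k - 1 a true subtraction in [nat]. *)
Lemma ground_state_transform (a : R) (k : nat) (mu : R) (xi : R -> R) :
  a <> 0 -> (1 <= k)%nat -> jacobi_solution a k 1 h_id mu xi ->
  sl_system (gs_coef a k) (gs_weight a k) (a ^ 2 * (2 - INR k) - mu)
    (fun x => xi x / ground_state a x)
    (fun x => sech x ^ (k - 1) * (Derive xi x + (tanh x + dlogB a x) * xi x)).
Proof.
  intros ha hk (D1 & D2 & HJ) x.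
  destruct k as [|m]; [lia|]. clear hk.
  replace (S m - 1)%nat with m by lia.
  pose proof (coefB_pos a x ha) as HB. pose proof (sqrt_lt_R0 _ HB) as HS.
  pose proof (sech_pos x) as Hs.
  assert (HG : ground_state a x <> 0).
  { apply Rgt_not_eq, ground_state_pos, ha. }
  pose proof (is_derive_ground_state a x ha) as DG.
  split.
  - pose proof (is_derive_div xi (ground_state a) x _ _ (Derive_correct _ _ (D1 x)) DG HG)
      as D.
    match type of D with is_derive _ _ ?l =>
      match goal with |- is_derive _ _ ?r => replace r with l; [exact D|] end end.
    assert (Hp : sech x ^ m <> 0) by (apply pow_nonzero; lra).
    unfold ground_state, gs_coef. simpl (sech x ^ S m). field. repeat split; lra.
  - pose proof (is_derive_dlogB a x ha) as Db. pose proof (is_derive_tanh x) as Dt.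
    pose proof (is_derive_sech_pow m x) as Ds.
    specialize (HJ x). rewrite jacobi_lhs_id in HJ by exact ha.
    pose proof (ground_state_potential a x (INR (S m)) ha) as E.
    apply is_derive_unique in Db as Eb.
    assert (D : is_derive
      (fun x => sech x ^ m * (Derive xi x + (tanh x + dlogB a x) * xi x)) x
      (- (INR m * tanh x * sech x ^ m) * (Derive xi x + (tanh x + dlogB a x) * xi x)
       + sech x ^ m * (Derive (Derive xi) x
           + ((sech x ^ 2 + Derive (dlogB a) x) * xi x
              + (tanh x + dlogB a x) * Derive xi x)))).
    { apply (is_derive_mult (fun y => sech y ^ m)
               (fun y => Derive xi y + (tanh y + dlogB a y) * xi y)); [exact Ds| |exact Rmult_comm].
      apply (is_derive_plus (Derive xi)); [apply Derive_correct, D2|].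
      apply (is_derive_mult (fun y => tanh y + dlogB a y) xi);
        [|apply Derive_correct, D1|exact Rmult_comm].
      apply (is_derive_plus tanh); [exact Dt|]. rewrite Eb. exact Db. }
    match type of D with is_derive _ _ ?l =>
      match goal with |- is_derive _ _ ?r => replace r with l; [exact D|] end end.
    rewrite S_INR in *.
    (* Both sides meet in this form. On the left, xi'' is eliminated by the Jacobi equation and the
       remaining potential is given by [ground_state_potential]; on the right, W / g is expanded. *)
    transitivity (sech x ^ m * ((a ^ 2 * (2 - (INR m + 1)) - mu) * sech x ^ 2 / coefB a x) * xi x).
    + replace ((a ^ 2 * (2 - (INR m + 1)) - mu) * sech x ^ 2 / coefB a x)
        with (- ((INR m + 1 - 2) * (sech x ^ 2 - tanh x * dlogB a x))
              - mu * sech x ^ 2 / coefB a x) by (rewrite E; field; lra).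
      replace (Derive (Derive xi) x) with
        (- ((dlogB a x - (INR m + 1 - 2) * tanh x) * Derive xi x
  + (Derive (dlogB a) x + (INR m + 1 - 1) * (sech x ^ 2 - tanh x ^ 2)
     - (2 * (INR m + 1) - 3) * tanh x * dlogB a x + mu * sech x ^ 2 / coefB a x) * xi x))
        by lra.
      ring.
    + unfold gs_weight, ground_state. rewrite pow_add. simpl (sech x ^ S m).
      field. lra.
Qed.

(** * Lower bound for the eigenvalues, and the conclusion *)

(** Growth exp (2 k x) of phi^2 against decay exp (- (k + 2) x) of the weight leaves exp ((k - 2)
    x), which is at least 1 for k >= 2 and x >= 0. *)
Lemma gs_mass_lower (a : R) (k : nat) (phi : R -> R) (eps x0 : R) :
  a <> 0 -> (2 <= k)%nat -> 0 < eps ->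
  (forall x, x0 <= x -> eps * exp (INR k * x) <= Rabs (phi x)) ->
  exists c, 0 < c /\ forall x, Rmax 0 x0 <= x -> c <= gs_weight a k x * phi x ^ 2.
Proof.
  intros ha hk Heps H.
  set (M := (a ^ 2 + 1) * sqrt (a ^ 2 + 1)).
  assert (HM : 0 < M).
  { pose proof (pow2_ge_0 a). apply Rmult_lt_0_compat; [|apply sqrt_lt_R0]; lra. }
  exists (eps ^ 2 / M). split; [apply Rdiv_lt_0_compat; [apply pow_lt|]; assumption|].
  intros x Hx. pose proof (Rmax_l 0 x0). pose proof (Rmax_r 0 x0).
  pose proof (gs_weight_lower a k x ha ltac:(lra)) as Hw. fold M in Hw.
  specialize (H x ltac:(lra)).
  pose proof (exp_pos (INR k * x)) as He.
  apply Rle_trans with (exp (- (INR (k + 2) * x)) / M * (eps * exp (INR k * x)) ^ 2).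
  - assert (Hk : 2 <= INR k) by (apply (le_INR 2); exact hk).
    replace (exp (- (INR (k + 2) * x)) / M * (eps * exp (INR k * x)) ^ 2)
      with (eps ^ 2 / M * exp ((INR k - 2) * x)).
    + rewrite <- (Rmult_1_r (eps ^ 2 / M)) at 1. apply Rmult_le_compat_l.
      * apply Rlt_le, Rdiv_lt_0_compat; [apply pow_lt|]; assumption.
      * pose proof (exp_ineq1_le ((INR k - 2) * x)). nra.
    + replace ((INR k - 2) * x) with (- (INR (k + 2) * x) + (INR k * x + INR k * x))
        by (rewrite plus_INR; simpl; ring).
      rewrite !exp_plus. field. lra.
  - rewrite <- (pow2_abs (phi x)). apply Rmult_le_compat.
    + apply Rlt_le, Rdiv_lt_0_compat; [apply exp_pos|exact HM].
    + apply pow2_ge_0.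
    + exact Hw.
    + apply pow_incr. split; [|exact H]. apply Rlt_le, Rmult_lt_0_compat; assumption.
Qed.

Lemma identity_eigenvalue_lower_bound (a : R) (k : nat) (mu : R) :
  a <> 0 -> (2 <= k)%nat -> identity_eigenvalue a k mu -> a ^ 2 * (2 - INR k) <= mu.
Proof.
  intros ha hk (xi & Hsol & (x1 & Hx1) & HL2).
  apply Rnot_lt_le. intros Hlt.
  pose proof (ground_state_transform a k mu xi ha ltac:(lia) Hsol) as Hsys.
  set (delta := a ^ 2 * (2 - INR k) - mu) in *.
  set (phi := fun x => xi x / ground_state a x) in *.
  match type of Hsys with sl_system _ _ _ _ ?q => set (Q := q) in * end.
  assert (Hd : 0 < delta) by (unfold delta; lra).
  assert (HP : forall x, 0 < gs_coef a k x) by (intros; apply gs_coef_pos, ha).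
  assert (HW : forall x, 0 < gs_weight a k x) by (intros; apply gs_weight_pos, ha).
  assert (HI : ex_RInt_gen (fun x => gs_weight a k x * phi x ^ 2)
                 (Rbar_locally m_infty) (Rbar_locally p_infty)).
  { refine (ex_RInt_gen_ext_eq _ _ _ HL2). intros x.
    symmetry. apply gs_weight_square, ha. }
  assert (Hk : 0 < INR k) by (apply lt_0_INR; lia).
  assert (HC : 0 < 2 ^ k / sqrt (Rmin (a ^ 2) 1)).
  { apply Rdiv_lt_0_compat; [apply pow_lt; lra|].
    apply sqrt_lt_R0, Rmin_pos; [apply pow2_gt_0, ha|lra]. }
  destruct (sl_product_nonzero _ _ _ _ _ HP HW Hd Hsys) as (x0 & Hx0).
  { exists x1. unfold phi. pose proof (ground_state_pos a x1 ha).
    apply Rmult_integral_contrapositive. split; [exact Hx1|].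
    apply Rinv_neq_0_compat; lra. }
  (* The sign of phi Q at [x0] selects the end where phi grows: the right end if positive, the left
     end, treated by reflection, if negative. *)
  destruct (Rdichotomy _ _ Hx0) as [Hneg | Hpos].
  - assert (HPe : forall x, gs_coef a k (- x) = gs_coef a k x)
      by (intros x; unfold gs_coef; rewrite sech_opp, coefB_opp; reflexivity).
    assert (HWe : forall x, gs_weight a k (- x) = gs_weight a k x)
      by (intros x; unfold gs_weight; rewrite sech_opp, coefB_opp; reflexivity).
    pose proof (sl_system_reflect _ _ _ _ _ HPe HWe Hsys) as Hsys'.
    destruct (sl_exp_growth _ _ _ _ _ (INR k) _ (- x0) HP HW Hd Hsys' Hk HC)
      as (eps & Heps & Hgrow).
    { intros x. apply gs_coef_upper, ha. }
    { rewrite Ropp_involutive. lra. }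
    destruct (gs_mass_lower a k _ eps _ ha hk Heps Hgrow) as (c & Hc & Hmass).
    apply (proj2 (ex_RInt_gen_tails _ c (Rmax 0 (- x0)) HI Hc)).
    intros x Hx. rewrite HWe. apply Hmass, Hx.
  - destruct (sl_exp_growth _ _ _ _ _ (INR k) _ x0 HP HW Hd Hsys Hk HC)
      as (eps & Heps & Hgrow).
    { intros x. apply gs_coef_upper, ha. }
    { lra. }
    destruct (gs_mass_lower a k _ eps _ ha hk Heps Hgrow) as (c & Hc & Hmass).
    apply (proj1 (ex_RInt_gen_tails _ c (Rmax 0 x0) HI Hc)). exact Hmass.
Qed.

Theorem theorem1p4 (k : nat) (a : R) (hk : (3 <= k)%nat) (ha : a <> 0) :
  identity_first_eigenvalue a k (a ^ 2 * (2 - INR k)) /\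
  identity_unstable a k.
Proof.
  assert (H : identity_eigenvalue a k (a ^ 2 * (2 - INR k))).
  { exists (ground_state a). split; [|split].
    - apply ground_state_solution, ha.
    - exists 0. apply Rgt_not_eq, ground_state_pos, ha.
    - apply ground_state_weighted_L2, ha. }
  split.
  - split; [exact H|]. intros mu. apply identity_eigenvalue_lower_bound; [exact ha|lia].
  - exists (a ^ 2 * (2 - INR k)). split; [exact H|].
    (* The eigenvalue is negative because a^2 > 0 and 2 - k <= - 1. *)
    assert (0 < a ^ 2) by (apply pow2_gt_0, ha).
    assert (3 <= INR k) by (apply (le_INR 3) in hk; simpl in hk; lra).
    nra.
Qed.
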